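(* Consider an instance of the two-machine flow shop problem $F2\,||\,C_{\max}$ with jobs indexed $1,\dots,n$ according to Johnson's sequence, with $A=\{1,\dots,n_A\}$ nonempty. Suppose that $P_{1A}\le P_{2A}-p^{\max}_{A1}$. Let $k_A\in\{1,\dots,n_A\}$ be the smallest index in $A$ such that $$\sum_{i\in A:\ p_{1,i}\le p_{1,k_A}} p_{1,i}\ \le\ \sum_{i\in A:\ p_{1,i}\le p_{1,k_A}} p_{2,i}\;-\;p^{\max}_{A1}\qquad\text{and}\qquad p_{1,k_A}<p_{1,k_A+1},$$ where the second condition is regarded as satisfied if $k_A=n_A$. Then, for the job set $A$ (that is, for the instance of $F2\,||\,C_{\max}$ consisting of the jobs of $A$ only), sequencing jobs $1,\dots,k_A$ in this (Johnson's) order, followed by jobs $k_A+1,\dots,n_A$ in any order, gives an optimal schedule.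
   Context: Two-machine flow shop $F2\,||\,C_{\max}$: a finite set of jobs must be processed first on machine $M_1$ and then on machine $M_2$; job $j$ requires processing time $p_{1,j}\ge 0$ on $M_1$ and $p_{2,j}\ge 0$ on $M_2$. All jobs are available at time $0$, each machine processes at most one job at a time, preemption is not allowed, and a job can start on $M_2$ only after completing on $M_1$. The goal is to minimize the makespan $C_{\max}$, i.e. the latest completion time on $M_2$. A sequence (permutation) of the jobs defines the permutation schedule in which both machines process the jobs in that order, each operation starting as early as possible. A schedule is optimal if its makespan is minimum among all feasible schedules (it is well known that some permutation schedule attains this minimum). Johnson's sequence: $A$ is the set of jobs with $p_{1,j}\le p_{2,j}$ and $B$ the set of jobs with $p_{1,j}>p_{2,j}$; first come the jobs of $A$ in nondecreasing order of $p_{1,j}$, then the jobs of $B$ in nonincreasing order of $p_{2,j}$ (ties broken arbitrarily). Jobs are indexed so that Johnson's sequence is $1,2,\dots,n$, with $A=\{1,\dots,n_A\}$ and $B=\{n_A+1,\dots,n\}$. Notation: $P_{1A}=\sum_{i\in A}p_{1,i}$, $P_{2A}=\sum_{i\in A}p_{2,i}$, $p^{\max}_{A1}=\max_{i\in A}p_{1,i}$. *)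

(* Defs.v *)
From mathcomp Require Import all_boot all_order all_algebra.

Set Implicit Arguments.
Unset Strict Implicit.
Unset Printing Implicit Defensive.

Import Order.TTheory GRing.Theory Num.Theory.

Local Open Scope ring_scope.

Section FlowShop.

Variables (R : realFieldType) (J : finType) (p1 p2 : J -> R).

Record schedule := Schedule { start1 : J -> R; start2 : J -> R }.

(* An operation occupies its machine during [s j, s j + p j); in particular
   an operation of length 0 never occupies the machine. *)
Definition one_at_a_time (S : {set J}) (p s : J -> R) : Prop :=
  forall (t : R) (i j : J), i \in S -> j \in S ->
    s i <= t < s i + p i -> s j <= t < s j + p j -> i = j.

(* The instance is the set of jobs S; start times outside S are irrelevant.
   Preemption is excluded by having a single start time per operation. *)
Definition feasible (S : {set J}) (x : schedule) : Prop :=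
  [/\ {in S, forall j, 0 <= start1 x j},
      {in S, forall j, start1 x j + p1 j <= start2 x j},
      one_at_a_time S p1 (start1 x)
    & one_at_a_time S p2 (start2 x)].

(* The default 0 matters only for S = set0, since completion times of a
   feasible schedule are nonnegative when the processing times are. *)
Definition makespan (S : {set J}) (x : schedule) : R :=
  \big[Num.max/0]_(j in S) (start2 x j + p2 j).

Definition optimal (S : {set J}) (x : schedule) : Prop :=
  feasible S x /\ forall y, feasible S y -> makespan S x <= makespan S y.

(* Times at which M1 and M2 become free once the jobs of s have been processed
   in this order, each operation starting as early as possible. *)
Definition free_times (s : seq J) : R * R :=
  foldl (fun c j => (c.1 + p1 j, Num.max (c.1 + p1 j) c.2 + p2 j)) (0, 0) s.

Definition perm_schedule (s : seq J) : schedule :=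
  let before j := free_times (take (index j s) s) in
  Schedule (fun j => (before j).1)
           (fun j => Num.max ((before j).1 + p1 j) (before j).2).

Definition jobsA : {set J} := [set j | p1 j <= p2 j].
Definition jobsB : {set J} := [set j | p2 j < p1 j].

(* Nonnegativity of p1 makes 0 a neutral default. *)
Definition pmaxA1 : R := \big[Num.max/0]_(j in jobsA) p1 j.

End FlowShop.

Section Johnson.

Variables (R : realFieldType) (n : nat) (p1 p2 : 'I_n -> R) (nA : nat).

(* Indices start at 0: j : 'I_n stands for the job of index j + 1, so that
   {1, ..., nA} is the set of the j with j < nA. *)
Definition johnson_indexed : Prop :=
  [/\ jobsA p1 p2 = [set j : 'I_n | (j < nA)%N],
      {in jobsA p1 p2 &, forall i j : 'I_n, (i <= j)%N -> p1 i <= p1 j}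
    & {in jobsB p1 p2 &, forall i j : 'I_n, (i <= j)%N -> p2 j <= p2 i}].

(* The last clause is vacuous when k is the last job of A. *)
Definition switch_index (k : 'I_n) : Prop :=
  [/\ k \in jobsA p1 p2,
      \sum_(i in jobsA p1 p2 | p1 i <= p1 k) p1 i <=
        \sum_(i in jobsA p1 p2 | p1 i <= p1 k) p2 i - pmaxA1 p1 p2
    & forall j : 'I_n, j = k.+1 :> nat -> (j < nA)%N -> p1 k < p1 j].

Definition smallest_switch_index (k : 'I_n) : Prop :=
  switch_index k /\ forall j : 'I_n, switch_index j -> (k <= j)%N.

End Johnson.

(* Main.v *)
Require Import Defs.
From mathcomp Require Import all_boot all_order all_algebra.
From mathcomp Require Import lra.

Set Implicit Arguments.
Unset Strict Implicit.
Unset Printing Implicit Defensive.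

Import Order.TTheory GRing.Theory Num.Theory.

Local Open Scope ring_scope.

(** The makespan of the permutation schedule of a sequence is the weight
    p1(s1) + p1(u) + p2(u) + p2(s2) of some splitting s1, u, s2 of the
    sequence: [u] is the last job that starts on the second machine without
    waiting for it ([free_times_critical]).  So it suffices to bound the weight
    of every splitting by the makespan of an arbitrary schedule of the same
    jobs, which need not be a permutation schedule
    ([perm_schedule_optimal]).

    If [u] is among the jobs up to the switch index, then [s1] holds jobs with
    p1 at most p1(u), and [s2] holds jobs with p1 at least p1(u), in whatever
    order the tail is.  This is all that is needed for the weight to be a lower
    bound on every makespan, because p1 <= p2 on the jobs of [s1]
    ([makespan_ge_split]).

    If [u] is in the tail, let r be the prefix up to the switch index and t1
    the jobs of the tail before [u].  The switch condition gives
    p1(r) + p1(u) <= p1(r) + pmax <= p2(r), and p1(t1) <= p2(t1), so the weight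
    is at most the total load of the second machine, which is a trivial lower
    bound ([makespan_ge_sum_p2]).

    A switch index exists because the last job of A satisfies the switch
    condition, by the assumption on the total loads. *)

(** * Lower bounds on the makespan of an arbitrary schedule *)

Section LowerBounds.

Variables (R : realFieldType) (J : finType).
Implicit Types (p s : J -> R) (S X : {set J}).

(** Empty operations may lie anywhere, even inside another operation, so the
    window is only required to contain the operations of positive length. *)
Lemma one_at_a_time_sum_le X p s (a b : R) :
    {in X, forall j, 0 <= p j} -> one_at_a_time X p s ->
    {in X, forall j, 0 < p j -> a <= s j /\ s j + p j <= b} -> a <= b ->
  \sum_(j in X) p j <= b - a.
Proof.
have [m] := ubnP #|X|; elim: m X b => // m IH X b Xm p_ge0 oneX inab ab.
case: (pickP [pred j in X | 0 < p j]) => [j0 /= Pj0|none]; last first.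
  rewrite big1 ?subr_ge0 // => j jX; apply/eqP.
  rewrite eq_le p_ge0 // andbT leNgt; apply/negP => pj_gt0.
  by have := none j; rewrite /= jX pj_gt0.
(* The operation that starts last; the other ones must end before it starts. *)
case: (arg_maxP (P := [pred j in X | 0 < p j]) s Pj0) => j /andP[jX pj_gt0] s_max.
have [asj sjb] := inab j jX pj_gt0.
rewrite (big_setD1 j)//= -lerBrDl.
suff : \sum_(i in X :\ j) p i <= s j - a by lra.
apply: IH => //.
- by move: Xm; rewrite (cardsD1 j) jX.
- by move=> i /setD1P[_ /p_ge0].
- by move=> t i i' /setD1P[_ iX] /setD1P[_ i'X]; apply: oneX.
- move=> i /setD1P[i_neq_j iX] pi_gt0; split; first by have [] := inab i iX pi_gt0.
  rewrite leNgt; apply/negP => sj_lt; case/eqP: i_neq_j.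
  have sij : s i <= s j by apply: s_max; rewrite /= iX.
  by apply: (oneX (s j)) => //; apply/andP; split=> //; lra.
Qed.

Variables (p1 p2 : J -> R) (S : {set J}) (y : schedule R J).
Hypotheses (p1_ge0 : forall j, 0 <= p1 j) (p2_ge0 : forall j, 0 <= p2 j).
Hypothesis feas : feasible p1 p2 S y.

Lemma completion_le_makespan j : j \in S -> start2 y j + p2 j <= makespan p2 S y.
Proof. by move=> jS; apply: (le_bigmax_cond _ (fun j => start2 y j + p2 j)). Qed.

Lemma makespan_lower_load2 X (a : R) :
    X \subset S -> {in X, forall j, a <= start2 y j} -> a <= makespan p2 S y ->
  a + \sum_(j in X) p2 j <= makespan p2 S y.
Proof.
move=> /subsetP XS Xa ab; rewrite -lerBrDl.
case: feas => _ _ _ one2; apply: (@one_at_a_time_sum_le _ _ (start2 y)) => //.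
- by move=> t i j /XS iS /XS jS; apply: one2.
- by move=> j jX _; split; [apply: Xa|apply/completion_le_makespan/XS].
Qed.

Lemma makespan_ge_sum_p2 : \sum_(j in S) p2 j <= makespan p2 S y.
Proof.
rewrite -[leLHS]add0r; case: (feas) => start_ge0 prec _ _.
apply: makespan_lower_load2 => //; last exact: bigmax_ge_id.
move=> j jS; apply: le_trans (prec j jS).
by rewrite addr_ge0 ?start_ge0.
Qed.

(** Johnson's bound, for schedules that may order the two machines
    differently.  Let [v] be the job of [U] that starts first on the first
    machine, and let theta be the start of [v] plus [p1 u].  No job of [U] can
    start on the second machine before theta.  A job of [D] of positive length that starts on
    the first machine before theta must precede [v] there, since [v] lasts at least
    until theta; the others form [W] and also reach the second machine after
    theta.  Hence p1(D minus W) + p1(u) <= theta and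
    theta + p2(W) + p2(U) is at most the makespan, and p1(W) <= p2(W). *)
Lemma makespan_ge_split (D U : {set J}) (u : J) :
    S = D :|: U -> [disjoint D & U] -> u \in U ->
    {in D, forall j, p1 j <= p2 j} -> {in D, forall j, p1 j <= p1 u} ->
    {in U, forall j, p1 u <= p1 j} ->
  \sum_(j in D) p1 j + p1 u + \sum_(j in U) p2 j <= makespan p2 S y.
Proof.
move=> defS disjDU uU p12 Dle Uge.
have DS j : j \in D -> j \in S by rewrite defS inE => ->.
have US j : j \in U -> j \in S by rewrite defS inE orbC => ->.
have [start_ge0 prec one1 _] := feas.
case: (arg_minP (P := [in U]) (start1 y) uU) => v vU v_min.
pose theta := start1 y v + p1 u.
pose W := [set j in D | theta <= start1 y j].
have WD j : j \in W -> j \in D by rewrite inE => /andP[].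
have U_theta j : j \in U -> theta <= start2 y j.
  move=> jU; apply: le_trans (prec j (US j jU)).
  by rewrite lerD ?v_min ?Uge.
(* An empty operation of D may also start between the start of v and theta;
   it adds nothing to the sum. *)
have early : \sum_(j in D :\: W) p1 j <= start1 y v - 0.
  apply: (@one_at_a_time_sum_le _ _ (start1 y)) => //.
  - by move=> t i j /setDP[/DS iS _] /setDP[/DS jS _]; apply: one1.
  - move=> j /setDP[jD]; rewrite inE jD /= -ltNge => j_lt pj_gt0.
    split; first exact/start_ge0/DS.
    have jS := DS j jD; have vS := US v vU.
    have pju := Dle j jD; have puv := Uge v vU.
    rewrite leNgt; apply/negP => v_lt.
    have jv : j = v.
      have [sjv|svj] := leP (start1 y j) (start1 y v).
        apply: (one1 (start1 y v))=> //; apply/andP; split=> //; lra.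
      apply: (one1 (start1 y j))=> //; apply/andP; split=> //;
        rewrite /theta in j_lt; lra.
    by move/pred0P/(_ j): disjDU; rewrite /= jD jv vU.
  - exact/start_ge0/US.
have late : theta + \sum_(j in W :|: U) p2 j <= makespan p2 S y.
  apply: makespan_lower_load2.
  - by apply/subsetP => j /setUP[/WD/DS|/US].
  - move=> j /setUP[|/U_theta //]; rewrite inE => /andP[jD th_le].
    by apply: le_trans th_le (le_trans _ (prec j (DS j jD))); rewrite lerDl.
  - apply: le_trans (U_theta u uU) (le_trans _ (completion_le_makespan (US u uU))).
    by rewrite lerDl.
have disjWU : [disjoint W & U].
  by apply: disjointWl disjDU; apply/subsetP => j /WD.
rewrite (eq_bigl [predU W & U] _ (fun j => in_setU j W U)) bigU //= in late.
have le12 : \sum_(j in W) p1 j <= \sum_(j in W) p2 j.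
  by apply: ler_sum => j /WD/p12.
have WsubD : W \subset D by apply/subsetP.
rewrite (big_setID W) /= (setIidPr WsubD).
by rewrite /theta in late; lra.
Qed.

Lemma makespan_ge_split_seq (s1 s2 : seq J) (u : J) :
    uniq (s1 ++ u :: s2) -> s1 ++ u :: s2 =i S ->
    {in s1, forall j, p1 j <= p2 j} -> {in s1, forall j, p1 j <= p1 u} ->
    {in s2, forall j, p1 u <= p1 j} ->
  \sum_(j <- s1) p1 j + p1 u + \sum_(j <- u :: s2) p2 j <= makespan p2 S y.
Proof.
rewrite cat_uniq => /and3P[uniq1 disj uniq2] memS p12 le1 le2.
have -> : \sum_(j <- s1) p1 j = \sum_(j in [set j in s1]) p1 j.
  by rewrite big_uniq //; apply: eq_bigl => j; rewrite inE.
have -> : \sum_(j <- u :: s2) p2 j = \sum_(j in [set j in u :: s2]) p2 j.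
  by rewrite big_uniq //; apply: eq_bigl => j; rewrite inE.
apply: makespan_ge_split.
- by apply/setP => j; rewrite !in_setU -memS mem_cat !inE.
- apply/pred0P => j /=; rewrite !in_set; apply/negP => /andP[j1 j2].
  by case/hasP: disj; exists j.
- by rewrite !inE eqxx.
- by move=> j; rewrite inE => /p12.
- by move=> j; rewrite inE => /le1.
- by move=> j; rewrite !inE => /predU1P[-> //|/le2].
Qed.

End LowerBounds.

(** * Permutation schedules *)

Section PermSchedule.

Variables (R : realFieldType) (J : finType) (p1 p2 : J -> R).
Hypotheses (p1_ge0 : forall j, 0 <= p1 j) (p2_ge0 : forall j, 0 <= p2 j).
Implicit Types s : seq J.

Local Notation free := (free_times p1 p2).

Lemma free_times_rcons s j :
  free (rcons s j) =
    ((free s).1 + p1 j, Num.max ((free s).1 + p1 j) (free s).2 + p2 j).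
Proof. by rewrite /free_times foldl_rcons. Qed.

Lemma free_times1 s : (free s).1 = \sum_(j <- s) p1 j.
Proof.
elim/last_ind: s => [|s j IH]; first by rewrite big_nil.
by rewrite free_times_rcons /= IH -cats1 big_cat big_seq1.
Qed.

Lemma free_times_cat_ge s s' :
  (free s).1 <= (free (s ++ s')).1 /\ (free s).2 <= (free (s ++ s')).2.
Proof.
elim/last_ind: s' => [|s' j [IH1 IH2]]; first by rewrite cats0.
rewrite -rcons_cat free_times_rcons /=; split.
  by rewrite (le_trans IH1) ?lerDl.
rewrite (le_trans IH2) // -[leLHS]addr0 lerD //.
by rewrite le_max lexx orbT.
Qed.

Lemma free_times_take s (m m' : nat) : (m <= m')%N ->
  (free (take m s)).1 <= (free (take m' s)).1 /\
  (free (take m s)).2 <= (free (take m' s)).2.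
Proof.
move=> /subnKC <-; rewrite takeD; exact: free_times_cat_ge.
Qed.

Lemma free_times_take_index s j : j \in s ->
  free (take (index j s).+1 s) =
    (start1 (perm_schedule p1 p2 s) j + p1 j,
     start2 (perm_schedule p1 p2 s) j + p2 j).
Proof.
move=> js; rewrite (take_nth j) ?index_mem // nth_index //.
exact: free_times_rcons.
Qed.

(** Once [i] precedes [j], both machines are free of [i] when [j] starts. *)
Lemma perm_schedule_ordered s i j : i \in s -> (index i s < index j s)%N ->
  let x := perm_schedule p1 p2 s in
  start1 x i + p1 i <= start1 x j /\ start2 x i + p2 i <= start2 x j.
Proof.
move=> is_ /(free_times_take s); rewrite (free_times_take_index is_) /= => -[le1 le2].
by split=> //; rewrite le_max le2 orbT.
Qed.

Lemma perm_schedule_feasible s (S : {set J}) :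
  s =i S -> feasible p1 p2 S (perm_schedule p1 p2 s).
Proof.
move=> memS.
have one p (st : J -> R) :
    (forall i j, i \in s -> (index i s < index j s)%N -> st i + p i <= st j) ->
  one_at_a_time S p st.
  move=> ord t i j; rewrite -!memS => si sj /andP[it ti] /andP[jt tj].
  case: (ltngtP (index i s) (index j s)) => [lt_ij|lt_ji|eq_ij].
  - by have := le_lt_trans (le_trans (ord i j si lt_ij) jt) ti; rewrite ltxx.
  - by have := le_lt_trans (le_trans (ord j i sj lt_ji) it) tj; rewrite ltxx.
  - exact: index_inj eq_ij.
split.
- by move=> j _; rewrite /= free_times1 sumr_ge0.
- by move=> j _; rewrite /= le_max lexx.
- by apply: one => i j si /(perm_schedule_ordered si)[].
- by apply: one => i j si /(perm_schedule_ordered si)[].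
Qed.

Lemma makespan_perm_schedule_le s (S : {set J}) :
  s =i S -> makespan p2 S (perm_schedule p1 p2 s) <= (free s).2.
Proof.
move=> memS; have := free_times_take s (leq0n (size s)).
rewrite take0 take_size => -[_ free_ge0].
apply: bigmax_le => // j; rewrite -memS => js.
have := free_times_take s (m := (index j s).+1) (m' := size s).
by rewrite take_size free_times_take_index // index_mem => /(_ js)[].
Qed.

(** The critical path of a permutation schedule: trace back from the last job
    to the last job that starts on the second machine as soon as the first one
    has completed it. *)
Lemma free_times_critical s : s != [::] ->
  exists s1 u s2, s = s1 ++ u :: s2 /\
    (free s).2 = \sum_(j <- s1) p1 j + p1 u + \sum_(j <- u :: s2) p2 j.
Proof.
elim/last_ind: s => // s j IH _; rewrite free_times_rcons /=.
have [le_c|lt_c] := leP ((free s).1 + p1 j) (free s).2; last first.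
  by exists s, j, [::]; rewrite cats1 big_seq1 free_times1.
have [s0|/IH[s1 [u [s2 [-> ->]]]]] := eqVneq s [::].
  (* Both machines are free at time 0, so the comparison forces p1 j = 0. *)
  exists [::], j, [::]; split; first by rewrite s0.
  move: le_c; rewrite s0 /= big_nil big_seq1 => le_c.
  have := p1_ge0 j; lra.
exists s1, u, (rcons s2 j); rewrite rcons_cat; split=> //.
by rewrite -rcons_cons -[rcons (u :: s2) j]cats1 big_cat big_seq1 !addrA.
Qed.

Lemma perm_schedule_optimal s (S : {set J}) : s =i S ->
    (forall s1 u s2, s = s1 ++ u :: s2 ->
     forall y, feasible p1 p2 S y ->
     \sum_(j <- s1) p1 j + p1 u + \sum_(j <- u :: s2) p2 j <= makespan p2 S y) ->
  optimal p1 p2 S (perm_schedule p1 p2 s).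
Proof.
move=> memS bound; split=> [|y feas]; first exact: perm_schedule_feasible.
apply: le_trans (makespan_perm_schedule_le memS) _.
have [->|/free_times_critical[s1 [u [s2 [def_s ->]]]]] := eqVneq s [::].
  exact: bigmax_ge_id.
exact: (bound s1 u s2).
Qed.

End PermSchedule.

(** * Relaxing Johnson's sequence *)

Lemma cat_cons_eq_cat (T : Type) (s1 s2 r t : seq T) (u : T) :
  s1 ++ u :: s2 = r ++ t ->
  (exists r2, r = s1 ++ u :: r2 /\ s2 = r2 ++ t) \/
  (exists t1, t = t1 ++ u :: s2 /\ s1 = r ++ t1).
Proof.
elim: r s1 => [|x r IH] [|y s1] /= => [<-|<-|[-> ->]|[-> /IH[]]].
- by right; exists [::].
- by right; exists (y :: s1).
- by left; exists r.
- by case=> r2 [-> ->]; left; exists r2.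
- by case=> t1 [-> ->]; right; exists t1.
Qed.

Section Johnson.

Variables (R : realFieldType) (n nA : nat) (p1 p2 : 'I_n -> R).
Hypotheses (p1_ge0 : forall j, 0 <= p1 j) (p2_ge0 : forall j, 0 <= p2 j).
Hypothesis johnson : johnson_indexed p1 p2 nA.

Local Notation A := (jobsA p1 p2).

Lemma mem_johnsonA (j : 'I_n) : (j \in A) = (j < nA)%N.
Proof. by case: johnson => -> _ _; rewrite inE. Qed.

Lemma johnsonA_le (i j : 'I_n) : (j < nA)%N -> (i <= j)%N -> p1 i <= p1 j.
Proof.
case: johnson => _ sorted1 _ jA ij; apply: sorted1 => //; rewrite mem_johnsonA //.
exact: leq_ltn_trans ij jA.
Qed.

Lemma le_pmaxA1 (j : 'I_n) : (j < nA)%N -> p1 j <= pmaxA1 p1 p2.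
Proof. by rewrite -mem_johnsonA => jA; apply: le_bigmax_cond. Qed.

(** The strict increase of [p1] after a switch index makes the threshold set
    in its definition an initial segment of Johnson's sequence. *)
Lemma switch_index_prefix k : switch_index p1 p2 nA k ->
  forall j : 'I_n, (j \in A) && (p1 j <= p1 k) = (j <= k)%N.
Proof.
case; rewrite mem_johnsonA => kA _ strict j; rewrite mem_johnsonA.
have [jk|kj] := leqP j k; first by rewrite (leq_ltn_trans jk) ?johnsonA_le.
apply/negbTE/negP => /andP[jA]; apply/negP; rewrite -ltNge.
have k1n : (k.+1 < n)%N := leq_ltn_trans kj (ltn_ord j).
apply: (@lt_le_trans _ _ (p1 (Ordinal k1n))); last exact: johnsonA_le.
by apply: strict => //=; apply: leq_ltn_trans jA.
Qed.

(** Boolean form of [switch_index], so that a minimum can be taken over the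
    finite type of jobs. *)
Definition switch_indexb (k : 'I_n) : bool :=
  [&& k \in A,
      \sum_(i in A | p1 i <= p1 k) p1 i <=
        \sum_(i in A | p1 i <= p1 k) p2 i - pmaxA1 p1 p2
    & [forall j : 'I_n, (j == k.+1 :> nat) ==> (j < nA)%N ==> (p1 k < p1 j)]].

Lemma switch_indexP k : reflect (switch_index p1 p2 nA k) (switch_indexb k).
Proof.
apply: (iffP and3P) => -[kA le_k strict]; split=> //.
  by move=> j /eqP jk jA; move/forallP/(_ j): strict; rewrite jk jA.
apply/forallP => j; apply/implyP => /eqP jk; apply/implyP; exact: strict.
Qed.

Lemma smallest_switch_index_exists k :
  switch_index p1 p2 nA k -> exists kA, smallest_switch_index p1 p2 nA kA.
Proof.
move=> /switch_indexP k_ok.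
case: (arg_minnP (fun j : 'I_n => j : nat) k_ok) => kA /switch_indexP kA_ok kA_min.
by exists kA; split=> // j /switch_indexP; apply: kA_min.
Qed.

Lemma last_switch_index (k : 'I_n) : k.+1 = nA ->
    \sum_(i in A) p1 i <= \sum_(i in A) p2 i - pmaxA1 p1 p2 ->
  switch_index p1 p2 nA k.
Proof.
move=> kA le_A.
have AE j : (j \in A) && (p1 j <= p1 k) = (j \in A).
  apply: andb_idr; rewrite mem_johnsonA -kA ltnS => jk.
  by apply: johnsonA_le => //; rewrite -kA.
split; first by rewrite mem_johnsonA -kA.
  by rewrite !(eq_bigl _ _ AE).
by move=> j ->; rewrite kA ltnn.
Qed.

Theorem switch_index_optimal k (t : seq 'I_n) : switch_index p1 p2 nA k ->
    perm_eq t [seq j : 'I_n <- enum 'I_n | (k < j < nA)%N] ->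
  optimal p1 p2 A
    (perm_schedule p1 p2 ([seq j : 'I_n <- enum 'I_n | (j <= k)%N] ++ t)).
Proof.
move=> k_switch perm_t; set r := [seq j <- _ | _].
have kA : (k < nA)%N by rewrite -mem_johnsonA; case: k_switch.
have mem_r j : (j \in r) = (j <= k)%N by rewrite mem_filter mem_enum andbT.
have mem_t j : (j \in t) = (k < j < nA)%N.
  by rewrite (perm_mem perm_t) mem_filter mem_enum andbT.
have mem_rt : r ++ t =i A.
  move=> j; rewrite mem_cat mem_r mem_t mem_johnsonA.
  by case: leqP => //= jk; rewrite (leq_ltn_trans jk).
have uniq_rt : uniq (r ++ t).
  rewrite cat_uniq filter_uniq ?enum_uniq //= (perm_uniq perm_t).
  rewrite filter_uniq ?enum_uniq // andbT; apply/hasPn => j.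
  by rewrite mem_t mem_r -ltnNge => /andP[].
have sorted_r : pairwise (fun i j : 'I_n => (i < j)%N) r.
  apply: pairwise_filter; rewrite -(pairwise_map val ltn) val_enum_ord.
  by rewrite -sorted_pairwise ?iota_ltn_sorted //; apply: ltn_trans.
have sum_r (p : 'I_n -> R) : \sum_(j <- r) p j = \sum_(j in A | p1 j <= p1 k) p j.
  rewrite big_filter big_enum_cond /=; apply: eq_bigl => j.
  by rewrite (switch_index_prefix k_switch) ?inE.
apply: perm_schedule_optimal => // s1 u s2 def_s y feas.
have p12 j : j \in r ++ t -> p1 j <= p2 j by rewrite mem_rt inE.
(* The critical job u lies either in the prefix r or in the tail t. *)
case: (cat_cons_eq_cat (esym def_s)) => [[r2 [def_r def_s2]]|[t1 [def_t def_s1]]].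
- have ur : u \in r by rewrite def_r mem_cat mem_head orbT.
  have uk : (u <= k)%N by rewrite -mem_r.
  apply: makespan_ge_split_seq; rewrite -?def_s //.
  + by move=> j js1; apply: p12; rewrite def_s mem_cat js1.
  + move: sorted_r; rewrite def_r pairwise_cat => /and3P[/allrelP lt1 _ _] j js1.
    by apply: johnsonA_le (leq_ltn_trans uk kA) (ltnW (lt1 j u js1 (mem_head _ _))).
  + move=> j js2; apply: johnsonA_le; last first.
      move: js2; rewrite def_s2 mem_cat mem_t => /orP[jr2|/andP[kj _]]; last first.
        exact: leq_trans uk (ltnW kj).
      move: sorted_r; rewrite def_r pairwise_cat /= => /and4P[_ _ /allP lt2 _].
      exact/ltnW/lt2.
    by rewrite -mem_johnsonA -mem_rt def_s mem_cat inE js2 !orbT.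
- apply: le_trans (makespan_ge_sum_p2 p1_ge0 p2_ge0 feas).
  rewrite -(eq_bigl _ _ mem_rt) -(big_uniq _ uniq_rt) /= def_s def_s1.
  have uA : (u < nA)%N.
    by rewrite -mem_johnsonA -mem_rt def_s mem_cat mem_head orbT.
  have [_ le_r _] := k_switch; rewrite -!sum_r in le_r.
  have le_t1 : \sum_(j <- t1) p1 j <= \sum_(j <- t1) p2 j.
    rewrite big_seq [leRHS]big_seq; apply: ler_sum => j jt1; apply: p12.
    by rewrite mem_cat def_t mem_cat jt1 orbT.
  have := le_pmaxA1 uA; rewrite !big_cat /=; lra.
Qed.

End Johnson.

Theorem mainTheorem1 (R : realFieldType) (n nA : nat) (p1 p2 : 'I_n -> R)
  (p1_ge0 : forall j, 0 <= p1 j) (p2_ge0 : forall j, 0 <= p2 j)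
  (nA_gt0 : (0 < nA)%N) (nA_le_n : (nA <= n)%N)
  (johnson : johnson_indexed p1 p2 nA)
  (P1A_le : \sum_(i in jobsA p1 p2) p1 i
            <= \sum_(i in jobsA p1 p2) p2 i - pmaxA1 p1 p2) :
  (exists kA : 'I_n, smallest_switch_index p1 p2 nA kA) /\
  (forall kA : 'I_n, smallest_switch_index p1 p2 nA kA ->
   forall t : seq 'I_n,
     perm_eq t [seq j : 'I_n <- enum 'I_n | (kA < j < nA)%N] ->
     optimal p1 p2 (jobsA p1 p2)
       (perm_schedule p1 p2 ([seq j : 'I_n <- enum 'I_n | (j <= kA)%N] ++ t))).
Proof.
split; last first.
  by move=> kA [kA_switch _] t; apply: switch_index_optimal.
have last_lt : (nA.-1 < n)%N by rewrite prednK.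
apply: (smallest_switch_index_exists (k := Ordinal last_lt)).
by apply: last_switch_index => //=; rewrite prednK.
Qed.
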